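(* Let $\alpha,\beta,\gamma\in\mathbb{R}$ with $\gamma\neq 0$, and let $(G_2,g,J)$ be the connected, simply connected three-dimensional Lorentzian Lie group with product structure $J$ whose Lie algebra $\mathfrak{g}$ has a pseudo-orthonormal basis $\{e_1,e_2,e_3\}$ ($e_3$ timelike) with $[e_1,e_2]=\gamma e_2-\beta e_3$, $[e_1,e_3]=-\beta e_2-\gamma e_3$, $[e_2,e_3]=\alpha e_1$. Let $c\in\mathbb{R}$. Then $(G_2,g,J)$ is a second kind algebraic Ricci soliton associated to the Kobayashi-Nomizu connection $\nabla^1$ with constant $c$ if and only if $\alpha=\beta=0$, $\gamma^2+c=0$, $\gamma\neq 0$. In particular, in that case $\widetilde{\mathrm{Ric}}^1(e_1)=-\gamma^2e_1$, $\widetilde{\mathrm{Ric}}^1(e_2)=-\gamma^2e_2$, $\widetilde{\mathrm{Ric}}^1(e_3)=0$, and $De_1=0$, $De_2=0$, $De_3=\gamma^2e_3$.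
   Context: The left-invariant Lorentzian metric $g$ satisfies $g(e_1,e_1)=g(e_2,e_2)=1$, $g(e_3,e_3)=-1$, $g(e_i,e_j)=0$ for $i\ne j$. All tensors and connections are left-invariant and evaluated on $\mathfrak{g}$. $\nabla$ is the Levi-Civita connection of $g$. The product structure is $Je_1=e_1$, $Je_2=e_2$, $Je_3=-e_3$, and $(\nabla_XJ)Y=\nabla_X(JY)-J(\nabla_XY)$. The canonical connection is $\nabla^0_XY=\nabla_XY-\frac12(\nabla_XJ)(JY)$ and the Kobayashi-Nomizu connection is $\nabla^1_XY=\nabla^0_XY-\frac14[(\nabla_YJ)(JX)-(\nabla_{JY}J)X]$, with curvature $R^1(X,Y)Z=\nabla^1_X\nabla^1_YZ-\nabla^1_Y\nabla^1_XZ-\nabla^1_{[X,Y]}Z$. Its Ricci tensor is $\rho^1(X,Y)=-g(R^1(X,e_1)Y,e_1)-g(R^1(X,e_2)Y,e_2)+g(R^1(X,e_3)Y,e_3)$; its symmetrization is $\widetilde\rho^1(X,Y)=\frac12(\rho^1(X,Y)+\rho^1(Y,X))$, and the operator $\widetilde{\mathrm{Ric}}^1$ is defined by $\widetilde\rho^1(X,Y)=g(\widetilde{\mathrm{Ric}}^1(X),Y)$. Second kind algebraic Ricci soliton associated to $\nabla^1$ with constant $c$ means: $\widetilde{\mathrm{Ric}}^1=c\,\mathrm{Id}+D$ where $D$ is a derivation of $\mathfrak{g}$, i.e. a linear map with $D[X,Y]=[DX,Y]+[X,DY]$ for all $X,Y\in\mathfrak{g}$. *)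

(* Defs.v *)
From HB Require Import structures.
From mathcomp Require Import all_boot all_order all_algebra.
From mathcomp Require Import sesquilinear.
From mathcomp Require Import reals.

Set Implicit Arguments.
Unset Strict Implicit.
Unset Printing Implicit Defensive.

Import Order.TTheory GRing.Theory Num.Theory.
Local Open Scope ring_scope.

(* A left-invariant structure on a connected, simply connected Lie group is
   represented by its value on the Lie algebra V: the Lie bracket, the metric,
   connections and the product structure become multilinear maps on V. *)

Section LeftInvariantGeometry.

Variables (R : realType) (V : vectType R).

Definition is_lie_bracket (br : {bilinear V -> V -> V}) : Prop :=
  (forall x : V, br x x = 0) /\
  (forall x y z : V, br x (br y z) + br y (br z x) + br z (br x y) = 0).

Definition is_derivation (br : {bilinear V -> V -> V}) (D : 'End(V)) : Prop :=
  forall x y : V, D (br x y) = br (D x) y + br x (D y).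

Definition pseudo_orthonormal_basis (g : {symmetric V}) (e1 e2 e3 : V) : Prop :=
  [/\ basis_of fullv [:: e1; e2; e3],
      [/\ g e1 e1 = 1, g e2 e2 = 1 & g e3 e3 = -1] &
      [/\ g e1 e2 = 0, g e1 e3 = 0 & g e2 e3 = 0]].

(* The functions g(y, z) are constant for left-invariant y and z, so the term
   x (g(y, z)) of metric compatibility vanishes. *)
Definition is_levi_civita (br : {bilinear V -> V -> V}) (g : {symmetric V})
    (nabla : {bilinear V -> V -> V}) : Prop :=
  (forall x y : V, nabla x y - nabla y x = br x y) /\
  (forall x y z : V, g (nabla x y) z + g y (nabla x z) = 0).

(* (nabla_x J) y *)
Definition cov_endo (nabla : V -> V -> V) (J : 'End(V)) (x y : V) : V :=
  nabla x (J y) - J (nabla x y).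

Definition canonical_connection (nabla : V -> V -> V) (J : 'End(V))
    (x y : V) : V :=
  nabla x y - 2^-1 *: cov_endo nabla J x (J y).

Definition kobayashi_nomizu_connection (nabla : V -> V -> V) (J : 'End(V))
    (x y : V) : V :=
  canonical_connection nabla J x y
  - 4^-1 *: (cov_endo nabla J y (J x) - cov_endo nabla J (J y) x).

Definition curvature (br nabla : V -> V -> V) (x y z : V) : V :=
  nabla x (nabla y z) - nabla y (nabla x z) - nabla (br x y) z.

Definition ricci (g : V -> V -> R) (curv : V -> V -> V -> V) (e1 e2 e3 : V)
    (x y : V) : R :=
  - g (curv x e1 y) e1 - g (curv x e2 y) e2 + g (curv x e3 y) e3.

Definition symmetrization (rho : V -> V -> R) (x y : V) : R :=
  2^-1 * (rho x y + rho y x).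

Definition is_ricci_operator (g rho : V -> V -> R) (Ric : 'End(V)) : Prop :=
  forall x y : V, rho x y = g (Ric x) y.

(* The symmetrized Ricci tensor of the Kobayashi-Nomizu connection. *)
Definition kn_sym_ricci (br : {bilinear V -> V -> V}) (g : {symmetric V})
    (nabla : {bilinear V -> V -> V}) (J : 'End(V)) (e1 e2 e3 : V) :
    V -> V -> R :=
  symmetrization
    (ricci g (curvature br (kobayashi_nomizu_connection nabla J)) e1 e2 e3).

Definition soliton_decomposition (br : {bilinear V -> V -> V})
    (Ric : 'End(V)) (c : R) (D : 'End(V)) : Prop :=
  is_derivation br D /\ Ric = c *: \1%VF + D.

(* It is an algebraic Ricci soliton of the second kind when Ric is the operator
   of the symmetrized Ricci tensor. *)
Definition algebraic_ricci_soliton (br : {bilinear V -> V -> V})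
    (Ric : 'End(V)) (c : R) : Prop :=
  exists D : 'End(V), soliton_decomposition br Ric c D.

End LeftInvariantGeometry.

(* Main.v *)
(* In the frame e1, e2, e3 the Koszul formula determines the Levi-Civita
   connection, hence the Kobayashi-Nomizu connection and the operator Ric:
     Ric e1 = -(gamma^2 + beta^2) e1,
     Ric e2 = -(gamma^2 + alpha beta) e2 + (alpha gamma / 2) e3,
     Ric e3 = -(alpha gamma / 2) e2.
   For D = Ric - c Id, the Leibniz rule on [e1, e2] and [e1, e3] gives
   c = -(gamma^2 + beta^2) - alpha beta, then
   alpha (gamma^2 + beta^2) = 0 and beta (gamma^2 + alpha beta) = 0;
   as gamma is nonzero, alpha = 0 and then beta = 0. *)

Require Import Defs.
From HB Require Import structures.
From mathcomp Require Import all_boot all_order all_algebra.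
From mathcomp Require Import sesquilinear.
From mathcomp Require Import reals ring lra.

Set Implicit Arguments.
Unset Strict Implicit.
Unset Printing Implicit Defensive.

Import Order.TTheory GRing.Theory Num.Theory.
Local Open Scope ring_scope.

(** * Koszul formula for left-invariant fields *)

Section LieAlgebra.

Variables (R : realType) (V : vectType R).
Variables (br nabla : {bilinear V -> V -> V}) (g : {symmetric V}).

Lemma symmetricC (x y : V) : g x y = g y x.
Proof. by rewrite hermC expr0 mul1r. Qed.

(** Metric compatibility at the three cyclic permutations of (x, y, z), with each bracket expanded
    by vanishing torsion, leaves a linear system that determines the left-hand side. *)
Lemma koszul (x y z : V) : is_levi_civita br g nabla ->
  g (nabla x y) z = 2^-1 * (g (br x y) z - g (br y z) x + g (br z x) y).
Proof.
move=> [torsion metric].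
have := (metric x y z, metric y z x, metric z x y).
rewrite -!torsion !linearBl /= (symmetricC y) (symmetricC z) (symmetricC x).
by move=> [[]]; lra.
Qed.

Lemma bracketC (x y : V) : is_lie_bracket br -> br x y = - br y x.
Proof.
move=> [alt _]; apply/eqP; rewrite -addr_eq0; apply/eqP.
by have := alt (x + y); rewrite linearDl !linearDr !alt add0r addr0.
Qed.

End LieAlgebra.

(** * Coordinates in a pseudo-orthonormal frame *)

Section Frame.

Variables (R : realType) (V : vectType R) (e1 e2 e3 : V).

(* Locked: otherwise rewriting with [vecD] or [vecZ] also unifies [vec] with
   arbitrary sums of scaled vectors. *)
Definition vec (a b c : R) : V := locked (a *: e1 + b *: e2 + c *: e3).

Lemma vec0 : vec 0 0 0 = 0.
Proof. by rewrite /vec -!lock !scale0r !addr0. Qed.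

Lemma vec1 : e1 = vec 1 0 0.
Proof. by rewrite /vec -!lock !scale0r scale1r !addr0. Qed.

Lemma vec2 : e2 = vec 0 1 0.
Proof. by rewrite /vec -!lock !scale0r scale1r add0r addr0. Qed.

Lemma vec3 : e3 = vec 0 0 1.
Proof. by rewrite /vec -!lock !scale0r scale1r !add0r. Qed.

Lemma vecD a b c a' b' c' :
  vec a b c + vec a' b' c' = vec (a + a') (b + b') (c + c').
Proof. by rewrite /vec -!lock !scalerDl addrACA (addrACA (a *: e1)). Qed.

Lemma vecZ k a b c : k *: vec a b c = vec (k * a) (k * b) (k * c).
Proof. by rewrite /vec -!lock !scalerDr !scalerA. Qed.

Lemma vecN a b c : - vec a b c = vec (- a) (- b) (- c).
Proof. by rewrite /vec -!lock !opprD !scaleNr. Qed.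

Definition vecE := (vecN, vecZ, vecD).

Lemma linear_vec (f : 'End(V)) a b c :
  f (vec a b c) = a *: f e1 + b *: f e2 + c *: f e3.
Proof. by rewrite /vec -!lock !linearD !linearZ. Qed.

Lemma bilinear_vec (f : {bilinear V -> V -> V}) a b c a' b' c' :
  f (vec a b c) (vec a' b' c') =
    a *: (a' *: f e1 e1 + b' *: f e1 e2 + c' *: f e1 e3)
    + b *: (a' *: f e2 e1 + b' *: f e2 e2 + c' *: f e2 e3)
    + c *: (a' *: f e3 e1 + b' *: f e3 e2 + c' *: f e3 e3).
Proof.
by rewrite /vec -!lock !linearDl !linearZl_LR !linearDr !linearZr_LR.
Qed.

Variable g : {symmetric V}.
Hypothesis he : pseudo_orthonormal_basis g e1 e2 e3.

Lemma metric_vec a b c a' b' c' :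
  g (vec a b c) (vec a' b' c') = a * a' + b * b' - c * c'.
Proof.
have [_ [g11 g22 g33] [g12 g13 g23]] := he.
rewrite /vec -!lock !linearDl !linearZl_LR !linearDr !linearZr_LR /=.
rewrite (symmetricC g e2 e1) (symmetricC g e3 e1) (symmetricC g e3 e2).
rewrite g11 g22 g33 g12 g13 g23; ring.
Qed.

Lemma vec_surj x : exists a b c, x = vec a b c.
Proof.
have [bas _ _] := he.
have := memvf x; rewrite -(span_basis bas) !span_cons span_nil addv0.
case/memv_addP=> _ /vlineP[a ->] [y y_in ->].
have /memv_addP[_ /vlineP[b ->] [_ /vlineP[c ->] ->]] := y_in.
by exists a, b, c; rewrite /vec -!lock addrA.
Qed.

Lemma metric_vec1 a b c : g (vec a b c) e1 = a.
Proof. by rewrite [X in g _ X]vec1 metric_vec; ring. Qed.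

Lemma metric_vec2 a b c : g (vec a b c) e2 = b.
Proof. by rewrite [X in g _ X]vec2 metric_vec; ring. Qed.

Lemma metric_vec3 a b c : g (vec a b c) e3 = - c.
Proof. by rewrite [X in g _ X]vec3 metric_vec; ring. Qed.

(** The sign on the third coordinate comes from [g e3 e3 = -1]. *)
Lemma vec_coord x : x = vec (g x e1) (g x e2) (- g x e3).
Proof.
have [a [b [c ->]]] := vec_surj x.
by rewrite metric_vec1 metric_vec2 metric_vec3 opprK.
Qed.

Lemma vec_inj a b c a' b' c' :
  vec a b c = vec a' b' c' -> [/\ a = a', b = b' & c = c'].
Proof.
move=> eqv; split.
- by rewrite -(metric_vec1 a b c) eqv metric_vec1.
- by rewrite -(metric_vec2 a b c) eqv metric_vec2.
- by apply: oppr_inj; rewrite -(metric_vec3 a b c) eqv metric_vec3.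
Qed.

(** Test vectors are given in coordinates so that [metric_vec] evaluates both sides; this reads off
    [nabla] from the Koszul formula and [Ric] from its defining identity. *)
Lemma metric_nondegenerate x y :
  (forall a b c, g x (vec a b c) = g y (vec a b c)) -> x = y.
Proof.
move=> eqg; rewrite (vec_coord x) (vec_coord y).
have eq1 : g x e1 = g y e1 by have := eqg 1 0 0; rewrite -vec1.
have eq2 : g x e2 = g y e2 by have := eqg 0 1 0; rewrite -vec2.
have eq3 : g x e3 = g y e3 by have := eqg 0 0 1; rewrite -vec3.
by rewrite eq1 eq2 eq3.
Qed.

End Frame.

(** * Connections and Ricci operator of the Lie algebra of G2 *)

Section G2.

Variables (R : realType) (alpha beta gamma : R) (V : vectType R).
Variables (br : {bilinear V -> V -> V}) (g : {symmetric V}) (e1 e2 e3 : V).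
Hypothesis hbr : is_lie_bracket br.
Hypothesis he : pseudo_orthonormal_basis g e1 e2 e3.
Hypothesis h12 : br e1 e2 = gamma *: e2 - beta *: e3.
Hypothesis h13 : br e1 e3 = - (beta *: e2) - gamma *: e3.
Hypothesis h23 : br e2 e3 = alpha *: e1.

Local Notation v := (vec e1 e2 e3).

Lemma bracket_vec a b c a' b' c' :
  br (v a b c) (v a' b' c') =
    v (alpha * (b * c' - c * b'))
      (gamma * (a * b' - b * a') - beta * (a * c' - c * a'))
      (- beta * (a * b' - b * a') - gamma * (a * c' - c * a')).
Proof.
have [alt _] := hbr.
have b12 : br e1 e2 = v 0 gamma (- beta)
  by rewrite /vec -!lock h12 scale0r add0r scaleNr.
have b13 : br e1 e3 = v 0 (- beta) (- gamma)
  by rewrite /vec -!lock h13 scale0r add0r !scaleNr.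
have b23 : br e2 e3 = v alpha 0 0
  by rewrite /vec -!lock h23 !scale0r !addr0.
have b0 x : br x x = v 0 0 0 by rewrite alt vec0.
rewrite bilinear_vec.
rewrite (bracketC e2 e1 hbr) (bracketC e3 e1 hbr) (bracketC e3 e2 hbr).
by rewrite !b0 b12 b13 b23 !vecE; congr vec; ring.
Qed.

Variables (J : 'End(V)) (nabla : {bilinear V -> V -> V}).
Hypothesis hJ : [/\ J e1 = e1, J e2 = e2 & J e3 = - e3].
Hypothesis hnabla : is_levi_civita br g nabla.

Lemma levi_civita_vec a b c a' b' c' :
  nabla (v a b c) (v a' b' c') =
    v (gamma * (b * b' + c * c') + alpha / 2 * (b * c' - c * b'))
      ((alpha / 2 - beta) * (a * c') - gamma * (b * a') + alpha / 2 * (c * a'))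
      ((alpha / 2 - beta) * (a * b') + alpha / 2 * (b * a') + gamma * (c * a')).
Proof.
apply: (metric_nondegenerate he) => p q r.
by rewrite (koszul _ _ _ hnabla) !bracket_vec !(metric_vec he); field.
Qed.

Lemma product_vec a b c : J (v a b c) = v a b (- c).
Proof.
have [J1 J2 J3] := hJ.
by rewrite linear_vec J1 J2 J3 /vec -!lock scalerN scaleNr.
Qed.

(** The first two coordinates involve only a', b' and the third only c': this connection preserves
    the eigenspaces of [J], so [J] is parallel for it. *)
Lemma kobayashi_nomizu_vec a b c a' b' c' :
  kobayashi_nomizu_connection nabla J (v a b c) (v a' b' c') =
    v (gamma * (b * b') - alpha * (c * b')) (beta * (c * a') - gamma * (b * a'))
      (- gamma * (a * c')).
Proof.
rewrite /kobayashi_nomizu_connection /canonical_connection /cov_endo.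
by rewrite !(product_vec, levi_civita_vec, vecE); congr vec; field.
Qed.

(** Before symmetrization rho(e2, e3) = - alpha gamma while rho(e3, e2) = 0, whence the factor 1/2
    in the mixed term. *)
Lemma kn_sym_ricci_vec a b c a' b' c' :
  kn_sym_ricci br g nabla J e1 e2 e3 (v a b c) (v a' b' c') =
    - (gamma ^+ 2 + beta ^+ 2) * (a * a')
    - (gamma ^+ 2 + alpha * beta) * (b * b')
    - alpha * gamma / 2 * (b * c' + c * b').
Proof.
rewrite /kn_sym_ricci /symmetrization /ricci /curvature.
(* Folding [vec e1 e2 e3] hides the occurrences of e1, e2, e3 inside it. *)
set w := vec e1 e2 e3.
rewrite (vec1 e1 e2 e3 : e1 = w _ _ _) (vec2 e1 e2 e3 : e2 = w _ _ _).
rewrite (vec3 e1 e2 e3 : e3 = w _ _ _).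
rewrite !(bracket_vec, kobayashi_nomizu_vec, vecE) !(metric_vec he).
by field.
Qed.

Variable Ric : 'End(V).
Hypothesis hRic : is_ricci_operator g (kn_sym_ricci br g nabla J e1 e2 e3) Ric.

(** The two off-diagonal entries have opposite signs because e3 is timelike. *)
Lemma ricci_operator_vec a b c :
  Ric (v a b c) =
    v (- (gamma ^+ 2 + beta ^+ 2) * a)
      (- (gamma ^+ 2 + alpha * beta) * b - alpha * gamma / 2 * c)
      (alpha * gamma / 2 * b).
Proof.
apply: (metric_nondegenerate he) => p q r.
by rewrite -hRic kn_sym_ricci_vec (metric_vec he); field.
Qed.

End G2.

(** * The soliton equation *)

Theorem theorem2p21 (R : realType) (alpha beta gamma : R) (hgamma : gamma != 0)
    (V : vectType R) (br : {bilinear V -> V -> V}) (hbr : is_lie_bracket br)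
    (g : {symmetric V}) (e1 e2 e3 : V)
    (he : pseudo_orthonormal_basis g e1 e2 e3)
    (h12 : br e1 e2 = gamma *: e2 - beta *: e3)
    (h13 : br e1 e3 = - (beta *: e2) - gamma *: e3)
    (h23 : br e2 e3 = alpha *: e1)
    (J : 'End(V)) (hJ : [/\ J e1 = e1, J e2 = e2 & J e3 = - e3])
    (nabla : {bilinear V -> V -> V}) (hnabla : is_levi_civita br g nabla)
    (Ric : 'End(V))
    (hRic : is_ricci_operator g (kn_sym_ricci br g nabla J e1 e2 e3) Ric)
    (c : R) :
  (algebraic_ricci_soliton br Ric c <->
     [/\ alpha = 0, beta = 0, gamma ^+ 2 + c = 0 & gamma != 0]) /\
  ([/\ alpha = 0, beta = 0, gamma ^+ 2 + c = 0 & gamma != 0] ->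
     [/\ Ric e1 = - gamma ^+ 2 *: e1,
         Ric e2 = - gamma ^+ 2 *: e2,
         Ric e3 = 0 &
         forall D : 'End(V), soliton_decomposition br Ric c D ->
           [/\ D e1 = 0, D e2 = 0 & D e3 = gamma ^+ 2 *: e3]]).
Proof.
have RicE := ricci_operator_vec hbr he h12 h13 h23 hJ hnabla hRic.
have brE := bracket_vec hbr h12 h13 h23.
(* [Ric] and c determine D, which serves both the forward implication and the final formulas for
   D. *)
have DE D : soliton_decomposition br Ric c D -> forall x, D x = Ric x - c *: x.
  by move=> [_ ->] x; rewrite add_lfunE scale_lfunE id_lfunE addrC addKr.
split; first split.
- move=> [D hD]; have hDE := DE D hD; have [hder _] := hD.
  have := hder (vec e1 e2 e3 1 0 0) (vec e1 e2 e3 0 1 0).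
  rewrite !(hDE, brE, RicE, vecE) => /(vec_inj he)[_ h122 h123].
  have := hder (vec e1 e2 e3 1 0 0) (vec e1 e2 e3 0 0 1).
  rewrite !(hDE, brE, RicE, vecE) => /(vec_inj he)[_ h132 _].
  (* The e2-component [h122] of the Leibniz rule on [e1, e2] is gamma times this relation. *)
  have cE : c = - (gamma ^+ 2 + beta ^+ 2) - alpha * beta.
    by apply: (mulfI hgamma); lra.
  have g2 : gamma ^+ 2 != 0 by rewrite expf_eq0.
  have gb : gamma ^+ 2 + beta ^+ 2 != 0.
    by rewrite paddr_eq0 ?sqr_ge0// negb_and g2.
  (* After eliminating c, [h123] amounts to gamma^2 (alpha - beta) = 0 and [h132] to gamma^2 (alpha
     + beta) + 2 alpha beta^2 = 0; their sum is 2 alpha (gamma^2 + beta^2) = 0. *)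
  have a0 : alpha = 0.
    apply: (mulIf gb); rewrite mul0r; move: h123 h132; rewrite cE; lra.
  have b0 : beta = 0.
    apply: (mulIf g2); rewrite mul0r; move: h123 h132; rewrite cE a0; lra.
  by split=> //; rewrite cE a0 b0; ring.
(* Here e1 acts diagonally on the abelian ideal spanned by e2 and e3, and D = diag(0, 0, gamma^2)
   kills e1 and is diagonal on that ideal, hence is a derivation. *)
- move=> [a0 b0 gc _]; exists (Ric - c *: \1%VF); split; last first.
    by rewrite addrC subrK.
  have hDE x : (Ric - c *: \1%VF) x = Ric x - c *: x.
    by rewrite add_lfunE opp_lfunE scale_lfunE id_lfunE.
  have cE : c = - gamma ^+ 2 by lra.
  move=> x y; have [x1 [x2 [x3 ->]]] := vec_surj he x.
  have [y1 [y2 [y3 ->]]] := vec_surj he y.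
  by rewrite !(hDE, brE, RicE, vecE) a0 b0 cE; congr vec; field.
- move=> [a0 b0 gc _].
  have cE : c = - gamma ^+ 2 by lra.
  have Ric1 : Ric e1 = - gamma ^+ 2 *: e1.
    by rewrite (vec1 e1 e2 e3) RicE vecE a0 b0; congr vec; field.
  have Ric2 : Ric e2 = - gamma ^+ 2 *: e2.
    by rewrite (vec2 e1 e2 e3) RicE vecE a0 b0; congr vec; field.
  have Ric3 : Ric e3 = 0.
    rewrite (vec3 e1 e2 e3) RicE a0 b0 -(vec0 e1 e2 e3).
    by congr vec; field.
  split=> // D /DE hDE; rewrite !hDE Ric1 Ric2 Ric3 cE !subrr.
  by split=> //; rewrite sub0r scaleNr opprK.
Qed.
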